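(* Let $X$ be a gauge space, and let $\widehat X$ be the set of Cauchy points of $X$ with the gauge consisting of the metrics $\hat d(\xi,\zeta)=\inf_{x\in X}\big(\xi_d(x)+\zeta_d(x)\big)$, one for each gauge metric $d$ of $X$. Then the gauge space $\widehat X$ is complete.
   Context: A metric on a set $X$ is a function $d\colon X\times X\to[0,\infty)$ with $d(x,x)=0$, $d(x,y)=d(y,x)$ and $d(x,y)+d(y,z)\ge d(x,z)$ for all $x,y,z$ (so $d(x,y)=0$ with $x\ne y$ is allowed). Write $d\ge d'$ for pointwise inequality. A gauge on $X$ is a nonempty set $\mathcal{G}$ of metrics on $X$ such that for any $d_1,d_2\in\mathcal{G}$ there is $d_3\in\mathcal{G}$ with $d_3\ge d_1$ and $d_3\ge d_2$. A gauge space is a set $X$ with a gauge; the elements of the gauge are called gauge metrics. A Cauchy point $\xi$ of a gauge space $X$ consists of a function $\xi_d\colon X\to[0,\infty)$ for each gauge metric $d$, such that: (1) $d(x,y)+\xi_d(y)\ge\xi_d(x)$ for all $d,x,y$; (2) $\xi_d(x)+\xi_d(y)\ge d(x,y)$ for all $d,x,y$; (3) $\inf_{x\in X}\xi_d(x)=0$ for each $d$ (with $\inf\emptyset=+\infty$); (4) for any gauge metrics $d_1,d_2$ there is a gauge metric $d_3$ with $d_3\ge\max(d_1,d_2)$ and $\xi_{d_3}\ge\max(\xi_{d_1},\xi_{d_2})$. Each $z\in X$ gives a Cauchy point $\hat z$ with $\hat z_d(x)=d(z,x)$; $\xi$ is represented by $z$ if $\xi=\hat z$. A gauge space is complete if every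 Cauchy point of it is represented by some point. *)

(* Defs.v *)
From mathcomp Require Import all_boot all_order all_algebra lra.
From mathcomp Require Import boolp classical_sets reals ereal.

Set Implicit Arguments.
Unset Strict Implicit.
Unset Printing Implicit Defensive.

Import Order.TTheory GRing.Theory Num.Theory.

Local Open Scope classical_set_scope.
Local Open Scope ring_scope.

(* Distinct points may be at distance zero. *)
Record metric (R : realType) (X : Type) := Metric {
  metric_fun :> X -> X -> R;
  metric_ge0 : forall x y, 0 <= metric_fun x y;
  metric_xx : forall x, metric_fun x x = 0;
  metric_sym : forall x y, metric_fun x y = metric_fun y x;
  metric_triangle : forall x y z,
    metric_fun x z <= metric_fun x y + metric_fun y z }.

Record gaugeSpace (R : realType) := GaugeSpace {
  gs_sort :> Type;
  gs_gauge : set (metric R gs_sort);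
  gs_gauge_nonempty : gs_gauge !=set0;
  gs_gauge_directed : forall d1 d2, gs_gauge d1 -> gs_gauge d2 ->
    exists d3, [/\ gs_gauge d3,
      forall x y, d1 x y <= d3 x y & forall x y, d2 x y <= d3 x y] }.
Arguments gs_gauge {R} X _ : rename.
Arguments gs_gauge_nonempty {R} X : rename.

Definition gauge_metric (R : realType) (X : gaugeSpace R) : Type :=
  set_type (gs_gauge X).

Definition gauge_metric_val (R : realType) (X : gaugeSpace R)
  (d : gauge_metric X) : metric R X := val d.
Coercion gauge_metric_val : gauge_metric >-> metric.

(* The infimum is taken in the extended reals, where inf set0 = +oo, so that
   an empty gauge space has no Cauchy points. *)
Record cauchyPoint (R : realType) (X : gaugeSpace R) := CauchyPoint {
  cp_fun :> gauge_metric X -> X -> R;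
  cp_ge0 : forall d x, 0 <= cp_fun d x;
  cp_lip : forall (d : gauge_metric X) x y,
    cp_fun d x <= d x y + cp_fun d y;
  cp_triangle : forall (d : gauge_metric X) x y,
    d x y <= cp_fun d x + cp_fun d y;
  cp_inf : forall d, ereal_inf (range (fun x => (cp_fun d x)%:E)) = 0%E;
  cp_directed : forall d1 d2 : gauge_metric X, exists d3 : gauge_metric X,
    (forall x y, Num.max (d1 x y) (d2 x y) <= d3 x y) /\
    (forall x, Num.max (cp_fun d1 x) (cp_fun d2 x) <= cp_fun d3 x) }.

Section PointCauchy.
Variables (R : realType) (X : gaugeSpace R) (z : X).

Lemma point_cauchy_lip (d : gauge_metric X) x y : d z x <= d x y + d z y.
Proof.
have := metric_triangle d z y x; rewrite (metric_sym d y x); lra.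
Qed.

Lemma point_cauchy_triangle (d : gauge_metric X) x y :
  d x y <= d z x + d z y.
Proof. by rewrite (metric_sym d z x); exact: metric_triangle. Qed.

Lemma point_cauchy_inf (d : gauge_metric X) :
  ereal_inf (range (fun x => (d z x)%:E)) = 0%E.
Proof.
apply/eqP; rewrite eq_le; apply/andP; split.
  by apply: ereal_inf_lbound; exists z => //; rewrite metric_xx.
by apply: le_ereal_inf_tmp => _ [x _ <-]; rewrite lee_fin metric_ge0.
Qed.

Lemma point_cauchy_directed (d1 d2 : gauge_metric X) :
  exists d3 : gauge_metric X,
    (forall x y, Num.max (d1 x y) (d2 x y) <= d3 x y) /\
    (forall x, Num.max (d1 z x) (d2 z x) <= d3 z x).
Proof.
have [d3 [Gd3 le13 le23]] := gs_gauge_directed (set_valP d1) (set_valP d2).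
exists (SigSub (mem_set Gd3)).
by split=> [x y|x]; rewrite ge_max; apply/andP; split; auto.
Qed.

Definition point_cauchy : cauchyPoint X :=
  @CauchyPoint R X (fun d x => d z x) (fun d => metric_ge0 d z)
    point_cauchy_lip point_cauchy_triangle point_cauchy_inf
    point_cauchy_directed.

End PointCauchy.

Definition represented_by (R : realType) (X : gaugeSpace R)
  (xi : cauchyPoint X) (z : X) : Prop := xi = point_cauchy z.

Definition gauge_complete (R : realType) (X : gaugeSpace R) : Prop :=
  forall xi : cauchyPoint X, exists z : X, represented_by xi z.

Section Completion.
Variables (R : realType) (X : gaugeSpace R).
Implicit Types (d : gauge_metric X) (xi zeta eta : cauchyPoint X).

Lemma cp_small xi d (e : R) : 0 < e -> exists x, xi d x < e.
Proof.
move=> e0; have : (ereal_inf (range (fun x => (xi d x)%:E)) < e%:E)%E.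
  by rewrite cp_inf lte_fin.
by move=> /ereal_inf_lt [_ [x _ <-]]; rewrite lte_fin; exists x.
Qed.

Lemma cp_mono xi d d' : (forall x y, d x y <= d' x y) ->
  forall x, xi d x <= xi d' x.
Proof.
move=> dd' x; apply/ler_addgt0Pr => e e0.
have [d3 [_ xi3]] := cp_directed xi d d'.
have e20 : 0 < e / 2 by lra.
have [y] := cp_small xi d3 e20.
have := xi3 y; rewrite ge_max => /andP[le1 le2].
have := cp_lip xi d x y; have := cp_triangle xi d' x y; have := dd' x y; lra.
Qed.

(* The index set is nonempty because X has a Cauchy point, so this is a
   genuine infimum and not the default value of inf. *)
Definition cp_dist d xi zeta : R := inf (range (fun x => xi d x + zeta d x)).

Lemma cp_dist_le d xi zeta x : cp_dist d xi zeta <= xi d x + zeta d x.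
Proof.
apply: ge_inf; last by exists x.
by exists 0 => _ [y _ <-]; rewrite addr_ge0 ?cp_ge0.
Qed.

Lemma le_cp_dist d xi zeta (a : R) :
  (forall x, a <= xi d x + zeta d x) -> a <= cp_dist d xi zeta.
Proof.
move=> H; apply: lb_le_inf => [|_ [x _ <-]] //.
have [x _] := cp_small xi d ltr01.
by exists (xi d x + zeta d x), x.
Qed.

Lemma cp_dist_ge0 d xi zeta : 0 <= cp_dist d xi zeta.
Proof. by apply: le_cp_dist => x; rewrite addr_ge0 ?cp_ge0. Qed.

Lemma cp_dist_xx d xi : cp_dist d xi xi = 0.
Proof.
apply/eqP; rewrite eq_le cp_dist_ge0 andbT; apply/ler_addgt0Pr => e e0.
have e20 : 0 < e / 2 by lra.
have [x] := cp_small xi d e20; have := cp_dist_le d xi xi x; lra.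
Qed.

Lemma cp_dist_sym d xi zeta : cp_dist d xi zeta = cp_dist d zeta xi.
Proof.
by rewrite /cp_dist; under eq_fun do rewrite addrC.
Qed.

Lemma cp_dist_triangle d xi zeta eta :
  cp_dist d xi eta <= cp_dist d xi zeta + cp_dist d zeta eta.
Proof.
rewrite -lerBlDr; apply: le_cp_dist => x; rewrite lerBlDr -lerBlDl.
apply: le_cp_dist => y.
have := cp_dist_le d xi eta y; have := cp_lip xi d y x.
have := cp_triangle zeta d y x; lra.
Qed.

Definition hat_metric d : metric R (cauchyPoint X) :=
  Metric (cp_dist_ge0 d) (cp_dist_xx d) (cp_dist_sym d) (cp_dist_triangle d).

Lemma hat_gauge_nonempty : range hat_metric !=set0.
Proof.
have [d Gd] := gs_gauge_nonempty X.
by exists (hat_metric (SigSub (mem_set Gd))); exists (SigSub (mem_set Gd)).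
Qed.

Lemma cp_dist_mono d d' : (forall x y, d x y <= d' x y) ->
  forall xi zeta, cp_dist d xi zeta <= cp_dist d' xi zeta.
Proof.
move=> dd' xi zeta; apply: le_cp_dist => x.
by apply: (le_trans (cp_dist_le _ _ _ x)); rewrite lerD ?cp_mono.
Qed.

Lemma hat_gauge_directed (D1 D2 : metric R (cauchyPoint X)) :
  range hat_metric D1 -> range hat_metric D2 ->
  exists D3, [/\ range hat_metric D3,
    forall xi zeta, D1 xi zeta <= D3 xi zeta &
    forall xi zeta, D2 xi zeta <= D3 xi zeta].
Proof.
move=> [d1 _ <-] [d2 _ <-].
have [d3 [Gd3 le13 le23]] := gs_gauge_directed (set_valP d1) (set_valP d2).
pose d : gauge_metric X := SigSub (mem_set Gd3).
by exists (hat_metric d); split; [exists d | exact: cp_dist_mono |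
  exact: cp_dist_mono].
Qed.

Definition completion : gaugeSpace R :=
  GaugeSpace hat_gauge_nonempty hat_gauge_directed.

End Completion.

(* Main.v *)
Require Import Defs.
From mathcomp Require Import reals.
From mathcomp Require Import all_boot all_order all_algebra lra.
From mathcomp Require Import boolp classical_sets ereal.

(** A Cauchy point [Xi] of the completion is determined by its values at the
    points [point_cauchy x], which are dense.  Restricting it along
    [x |-> point_cauchy x] therefore gives the candidate: the point [xi] with
    [xi d x = Xi (hat_gauge d) (point_cauchy x)].  Everything rests on the
    identity [cp_dist d zeta (point_cauchy z) = zeta d z] ([cp_dist_point]): it
    says both that [x |-> point_cauchy x] is isometric, so that the axioms of
    [Xi] restrict to those of [xi], and that [zeta] comes within [e] of a point
    [point_cauchy z] as soon as [zeta d z < e], which is the density.  By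
    density, the infimum over [X] that defines the distance from [xi] to [zeta]
    is the value of [Xi] at [zeta] ([cp_dist_restriction]), that is, [xi]
    represents [Xi]. *)

Set Implicit Arguments.
Unset Strict Implicit.
Unset Printing Implicit Defensive.

Import Order.TTheory GRing.Theory Num.Theory.

Local Open Scope classical_set_scope.
Local Open Scope ring_scope.

Lemma cauchy_point_ext (R : realType) (X : gaugeSpace R)
  (xi zeta : cauchyPoint X) :
  (forall d x, xi d x = zeta d x) -> xi = zeta.
Proof.
move: xi zeta => [f f0 flip ftri finf fdir] [g g0 glip gtri ginf gdir] /= fg.
have {}fg : f = g by apply/funext => d; apply/funext => x.
by subst g; congr CauchyPoint; exact: Prop_irrelevance.
Qed.

Lemma ereal_inf_range_eq0 (R : realType) (T : Type) (f : T -> R) :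
  (forall x, 0 <= f x) -> (forall e, 0 < e -> exists x, f x < e) ->
  ereal_inf (range (fun x => (f x)%:E)) = 0%E.
Proof.
move=> f0 fsmall; apply/eqP; rewrite eq_le; apply/andP; split; last first.
  by apply: le_ereal_inf_tmp => _ [x _ <-]; rewrite lee_fin.
apply/lee_addgt0Pr => e /fsmall [x fxe].
rewrite add0e; apply: (@le_trans _ _ (f x)%:E); last by rewrite lee_fin ltW.
by apply: ereal_inf_lbound; exists x.
Qed.

(** The infimum defining the distance is attained at [z] itself: every other
    term is at least [zeta d z] because [zeta d] is 1-Lipschitz. *)
Lemma cp_dist_point (R : realType) (X : gaugeSpace R) (d : gauge_metric X)
  (zeta : cauchyPoint X) (z : X) :
  cp_dist d zeta (point_cauchy z) = zeta d z.
Proof.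
apply/eqP; rewrite eq_le; apply/andP; split.
  by have := cp_dist_le d zeta (point_cauchy z) z; rewrite /= metric_xx addr0.
by apply: le_cp_dist => x /=; rewrite addrC; exact: cp_lip.
Qed.

Definition hat_gauge (R : realType) (X : gaugeSpace R) (d : gauge_metric X) :
    gauge_metric (completion X) :=
  SigSub (mem_set (imageT (@hat_metric R X) d)).

Lemma hat_gauge_surj (R : realType) (X : gaugeSpace R)
  (D : gauge_metric (completion X)) : exists d, D = hat_gauge d.
Proof.
have [d _ dD] := set_valP D.
by exists d; apply: val_inj; rewrite /= dD.
Qed.

Section Restriction.
Variables (R : realType) (X : gaugeSpace R) (Xi : cauchyPoint (completion X)).
Implicit Types (d : gauge_metric X) (x y : X) (zeta : cauchyPoint X).

Let Xi_lip d zeta eta :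
  Xi (hat_gauge d) zeta <= cp_dist d zeta eta + Xi (hat_gauge d) eta.
Proof. exact: (cp_lip Xi (hat_gauge d)). Qed.

Let f d x : R := Xi (hat_gauge d) (point_cauchy x).

Let f_ge0 d x : 0 <= f d x. Proof. exact: cp_ge0. Qed.

Let f_lip d x y : f d x <= d x y + f d y.
Proof.
by have := Xi_lip d (point_cauchy x) (point_cauchy y); rewrite cp_dist_point.
Qed.

Let f_triangle d x y : d x y <= f d x + f d y.
Proof.
have := cp_triangle Xi (hat_gauge d) (point_cauchy x) (point_cauchy y).
by rewrite [X in X <= _]cp_dist_point.
Qed.

(** Some [zeta] nearly annihilates [Xi], and [zeta] is itself close to a point
    of [X]. *)
Let f_inf d : ereal_inf (range (fun x => (f d x)%:E)) = 0%E.
Proof.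
apply: ereal_inf_range_eq0 => // e e0.
have e20 : 0 < e / 2 by lra.
have [zeta Xizeta] := cp_small Xi (hat_gauge d) e20.
have [x zetax] := cp_small zeta d e20.
exists x; have := Xi_lip d (point_cauchy x) zeta.
rewrite cp_dist_sym cp_dist_point -/(f d x); lra.
Qed.

Let f_directed d1 d2 : exists d3,
  (forall x y, Num.max (d1 x y) (d2 x y) <= d3 x y) /\
  (forall x, Num.max (f d1 x) (f d2 x) <= f d3 x).
Proof.
have [D [leD leXi]] := cp_directed Xi (hat_gauge d1) (hat_gauge d2).
have [d3 Dd3] := hat_gauge_surj D; subst D.
exists d3; split=> [x y|x]; last exact: leXi.
have := leD (point_cauchy x) (point_cauchy y).
by rewrite /gauge_metric_val /= !cp_dist_point.
Qed.

Definition restriction : cauchyPoint X :=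
  CauchyPoint f_ge0 f_lip f_triangle f_inf f_directed.

(** Moving from [zeta] to [point_cauchy x] changes [Xi] by at most [zeta d x],
    so the terms [Xi (point_cauchy x) + zeta d x] of the infimum lie between
    [Xi zeta] and [Xi zeta + 2 * zeta d x], and [zeta d x] can be made small. *)
Lemma cp_dist_restriction d zeta :
  cp_dist d restriction zeta = Xi (hat_gauge d) zeta.
Proof.
apply/eqP; rewrite eq_le; apply/andP; split; last first.
  apply: le_cp_dist => x; have := Xi_lip d zeta (point_cauchy x).
  by rewrite cp_dist_point addrC.
apply/ler_addgt0Pr => e e0.
have e20 : 0 < e / 2 by lra.
have [x zetax] := cp_small zeta d e20.
have := cp_dist_le d restriction zeta x.
have := Xi_lip d (point_cauchy x) zeta.
rewrite cp_dist_sym cp_dist_point /= -/(f d x); lra.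
Qed.

End Restriction.

Theorem mainTheorem4 (R : realType) (X : gaugeSpace R) :
  gauge_complete (completion X).
Proof.
move=> Xi; exists (restriction Xi); apply: cauchy_point_ext => D zeta.
have [d ->] := hat_gauge_surj D.
by rewrite -cp_dist_restriction.
Qed.
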